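(* Let $k=2n+1$ be a fixed odd positive integer. For all real $x \ge k+1$ the following double inequality holds: $$\frac{p_{k}(x)}{p_{k}(x)+1}\cdot\big(-r_{k}(x)\big) \;\le\; \frac{\operatorname{Re} A(x)}{\Gamma(x+2)} \;<\; -r_{k}(x),$$ and equality (in the left-hand inequality) holds for $x=k+1$.
   Context: For real $x>-2$ the alternating Kurepa function is given by $$A(x)=\int_0^\infty e^{-t}\,\frac{t^{x+1}-(-1)^{x}t}{t+1}\,dt,\qquad (-1)^x=e^{i\pi x},$$ so that $$\operatorname{Re}A(x)=\int_0^\infty e^{-t}\,\frac{t^{x+1}-\cos(\pi x)\,t}{t+1}\,dt .$$ The polynomials $p_m$ are defined by $p_0(z)=1$ and $p_m(z)=(z-m+1)\,p_{m-1}(z)+(-1)^m$ for $m\ge 1$. The rational functions $r_m(z)$ (defined for $z\in\mathbb{C}\setminus\{-1,0,1,\ldots,m-2\}$, this set being $\{-1\}$ for $m=1$) are given by $r_1(z)=-\frac{1}{z+1}$, $r_2(z)=\frac{z-1}{z(z+1)}$ and, for $m\ge3$, $$r_m(z)=-\frac{z-m+1}{z-m+2}\,r_{m-1}(z)+\frac{1}{z-m+2}\,r_{m-2}(z).$$ *)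

(* Defs.v *)
From HB Require Import structures.
From mathcomp Require Import all_boot all_order all_algebra.
From mathcomp Require Import complex.
From mathcomp Require Import all_classical all_reals all_analysis.

Set Implicit Arguments.
Unset Strict Implicit.
Unset Printing Implicit Defensive.

Import Order.TTheory GRing.Theory Num.Theory.
Import numFieldNormedType.Exports.

Local Open Scope classical_set_scope.
Local Open Scope ring_scope.
Local Open Scope complex_scope.

Section Integrals.
Variable R : realType.

(* Euler's integral of the second kind, for x > 0. *)
Definition Gamma (x : R) : R :=
  (\int[@lebesgue_measure R]_(t in `[0%R, +oo[) (t `^ (x - 1) * expR (- t)))%R.

(* A complex-valued function is integrated componentwise. *)
Definition Cintegral (D : set R) (f : R -> R[i]) : R[i] :=
  (\int[@lebesgue_measure R]_(t in D) complex.Re (f t))%R +i*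
  (\int[@lebesgue_measure R]_(t in D) complex.Im (f t))%R.

(* e^(i theta) *)
Definition expi (theta : R) : R[i] := cos theta +i* sin theta.

(* The alternating Kurepa function at a real x > -2; the factor
   [expi (pi * x)] is the branch e^(i pi x) of (-1)^x. *)
Definition kurepaA (x : R) : R[i] :=
  Cintegral `[0%R, +oo[ (fun t =>
    (expR (- t))%:C *
    (((t `^ (x + 1))%:C - expi (pi * x) * t%:C) / (t + 1)%:C)).

End Integrals.

Fixpoint kurepa_p (F : comNzRingType) (m : nat) : {poly F} :=
  if m is m'.+1 then
    ('X - m%:R%:P + 1) * kurepa_p F m' + (-1) ^+ m
  else 1.

(* The sequence starts at m = 1; the value at m = 0 is a dummy. As a function on
   the field F, [kurepa_r m] is meaningful at z outside {-1, 0, ..., m - 2}. *)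
Fixpoint kurepa_r (F : fieldType) (m : nat) (z : F) : F :=
  match m with
  | 0 => 0
  | 1 => - (z + 1)^-1
  | 2 => (z - 1) / (z * (z + 1))
  | (m2.+1 as m1).+1 =>
      - ((z - m%:R + 1) / (z - m%:R + 2)) * kurepa_r m1 z
      + (z - m%:R + 2)^-1 * kurepa_r m2 z
  end.

(* Main.v *)
Require Import Defs.
From HB Require Import structures.
From mathcomp Require Import all_boot all_order all_algebra.
From mathcomp Require Import complex ring lra.
From mathcomp Require Import all_classical all_reals all_analysis.
From mathcomp Require Import measurable_realfun.

Set Implicit Arguments.
Unset Strict Implicit.
Unset Printing Implicit Defensive.

Import Order.TTheory GRing.Theory Num.Theory.
Import numFieldNormedType.Exports.

Local Open Scope ring_scope.

(** Write [ReA] for the real part of the alternating Kurepa function. Everything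
    follows from the functional equation [ReA (y + 1) + ReA y = Gamma (y + 2)]
    ([ReA_rec]) and from one inequality, [ReA y >= y / 80] for [y >= 0]
    ([ReA_ge]).

    Applying the functional equation [m] times downwards from [x] gives
    [ReA x] as an alternating sum of [Gamma (x + 1 - j)], [j < m], plus
    [(-1)^m ReA (x - m)]. Divided by [Gamma (x + 2)], the alternating sum becomes a
    sum of inverse falling factorials, which is exactly [(-1)^m r_m(x)], because the
    recurrence of [r_m] makes the sums [r_(m+1) + r_m] telescope as a product
    ([kurepa_r_succ_add], [ReA_descent]). For odd [k] this reads
      [ReA x / Gamma (x + 2) = - r_k(x) - ReA (x - k) / Gamma (x + 2)],
    and the upper bound is the positivity of [ReA] at [x - k >= 1].

    For the lower bound, [p_(m-1)] is up to sign the numerator of [r_m]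
    ([kurepa_r_falling]), whence for odd [k]
      [p_k / (p_k + 1) * (- r_k) = - r_k - Gamma (x - k + 1) / Gamma (x + 2)]
    ([kurepa_p_quotient]). By the functional equation once more, the gap between this
    and [ReA x / Gamma (x + 2)] is [ReA (x - k - 1) / Gamma (x + 2)]. It is
    nonnegative, and zero when [x = k + 1] since the integrand of [ReA 0] vanishes.

    The analytic core is the positivity of [ReA]. Bounding the cosine by 1 and
    [t `^ y] by [1 + y * ln t] from below reduces it to the positivity of the
    integral of [exp(-t) t ln(t) / (t + 1)], whose value is only about 0.03. It is
    obtained from a rational minorant of [ln] ([ln_minor_le_ln]), built so that
    after multiplication by [t / (t + 1)] it has the form [H - H'] with [H] rational;
    then [exp(-t) (H - H')] has the primitive [- exp(-t) H] and its integral is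
    [H 0 = 1/80] ([integral_minor]). *)

(** * The recurrences *)

Lemma kurepa_p_rec (F : comNzRingType) (m : nat) (z : F) :
  (kurepa_p F m.+1).[z] = (z - m%:R) * (kurepa_p F m).[z] + (-1) ^+ m.+1.
Proof.
rewrite /= !hornerE -natr1.
by rewrite opprD addrA subrK.
Qed.

(** The three-term recurrence extends down to the explicit [kurepa_r 2] when
    the sequence is started at [kurepa_r 0 = 0]. *)
Lemma kurepa_r_rec (F : fieldType) (m : nat) (z : F) :
  kurepa_r m.+2 z =
  (- (z - m%:R - 1) * kurepa_r m.+1 z + kurepa_r m z) / (z - m%:R).
Proof.
case: m => [|m].
  rewrite /= subr0 addr0 invfM; ring.
have -> : m.+1%:R = m.+3%:R - 2 :> F by rewrite -!natr1; ring.
rewrite [LHS]/= -/(kurepa_r m.+2 z) -/(kurepa_r m.+1 z).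
rewrite (_ : z - (m.+3%:R - 2) = z - m.+3%:R + 2); ring.
Qed.

Definition falling (F : comNzRingType) (m : nat) (z : F) : F :=
  \prod_(i < m) (z - i%:R).

Lemma fallingS (F : comNzRingType) (m : nat) (z : F) :
  falling m.+1 z = falling m z * (z - m%:R).
Proof. by rewrite /falling big_ord_recr. Qed.

Lemma falling_gt0 (R : realFieldType) (m : nat) (z : R) :
  m%:R < z + 1 -> 0 < falling m z.
Proof.
elim: m => [_|m IH]; first by rewrite /falling big_ord0.
rewrite -natr1 fallingS => h; apply: mulr_gt0; first by apply: IH; lra.
by lra.
Qed.

(** Rewriting the recurrence as
    [r_(m+2) + r_(m+1) = (r_(m+1) + r_m) / (z - m)] shows that consecutive sums
    form a product. Hence [(-1)^m r_m] is the partial sum of an alternating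
    series of inverse falling factorials. *)
Lemma kurepa_r_succ_add (R : realFieldType) (m : nat) (z : R) :
  m%:R < z + 1 -> kurepa_r m.+1 z + kurepa_r m z = - (falling m.+1 (z + 1))^-1.
Proof.
elim: m => [h|m IH].
  by rewrite /= addr0 fallingS /falling big_ord0 subr0 mul1r.
rewrite -natr1 => h.
have zm0 : z - m%:R != 0 by apply: lt0r_neq0; lra.
rewrite fallingS (_ : z + 1 - m.+1%:R = z - m%:R); last by rewrite -natr1; ring.
rewrite invfM -mulNr -IH; last by lra.
by rewrite kurepa_r_rec; field.
Qed.

(** Over the common denominator [falling m.+1 (z + 1)], the alternating sum
    [(-1)^(m+1) r_(m+1)] has a numerator obeying the recurrence of the
    polynomials [kurepa_p]. *)
Lemma kurepa_r_falling (R : realFieldType) (m : nat) (z : R) :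
  m%:R < z + 1 ->
  kurepa_r m.+1 z * falling m.+1 (z + 1) = (-1) ^+ m.+1 * (kurepa_p R m).[z].
Proof.
elim: m => [h|m IH].
  rewrite fallingS /falling big_ord0 /= hornerC subr0 mul1r; field.
  by apply: lt0r_neq0; lra.
rewrite -natr1 => h; have := @kurepa_r_succ_add _ m.+1 z; rewrite -natr1 => /(_ h).
have f0 : falling m.+2 (z + 1) != 0.
  by apply: lt0r_neq0; apply: falling_gt0; rewrite -!natr1; lra.
move=> /(canRL (addrK _)) ->; rewrite mulrBl mulNr mulVf//.
rewrite fallingS mulrA IH; last by lra.
have e2 : (-1 : R) ^+ m.+1 * (-1) ^+ m.+1 = 1.
  by rewrite -exprD addnn -mul2n exprM sqrrN !expr1n.
rewrite kurepa_p_rec [(-1) ^+ m.+2]exprS -natr1.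
set e := (-1) ^+ m.+1 in e2 *; set p := (_.[_]).
rewrite -{1}e2; ring.
Qed.

(** The bound 1 reproduces itself: a factor [z - m] of at least 2 outweighs the
    perturbation by a sign. *)
Lemma kurepa_p_ge1 (R : realFieldType) (m : nat) (z : R) :
  m%:R + 1 <= z -> 1 <= (kurepa_p R m).[z].
Proof.
elim: m => [_|m IH]; first by rewrite /= hornerC.
rewrite -natr1 => h; rewrite kurepa_p_rec.
have p1 : 1 <= (kurepa_p R m).[z] by apply: IH; lra.
have : -1 <= (-1 : R) ^+ m.+1.
  by rewrite -signr_odd; case: odd; rewrite ?expr1 ?expr0; lra.
nra.
Qed.

(** For odd index, [p_(m+1) + 1 = (x - m) p_m], so the correction to [- r_(m+1)]
    collapses to the next term of the alternating series. *)
Lemma kurepa_p_quotient (R : realFieldType) (m : nat) (x : R) :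
  ~~ odd m -> m%:R + 1 <= x ->
  (kurepa_p R m.+1).[x] / ((kurepa_p R m.+1).[x] + 1) * (- kurepa_r m.+1 x) =
  - kurepa_r m.+1 x - (falling m.+2 (x + 1))^-1.
Proof.
move=> evenm mx; have p_ge1 := kurepa_p_ge1 mx.
have m_ge0 : 0 <= m%:R :> R := ler0n R m.
have sgn : (-1 : R) ^+ m.+1 = -1 by rewrite -signr_odd /= evenm expr1.
have f0 : falling m.+1 (x + 1) != 0 by rewrite lt0r_neq0// falling_gt0// -natr1; lra.
have rE : kurepa_r m.+1 x = - (kurepa_p R m).[x] / falling m.+1 (x + 1).
  by apply/(canRL (mulfK f0)); rewrite kurepa_r_falling ?sgn ?mulN1r//; lra.
rewrite fallingS -natr1 rE kurepa_p_rec sgn.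
move: p_ge1; set p := (kurepa_p R m).[x] => p_ge1.
have p0 : p != 0 by rewrite lt0r_neq0//; lra.
have xm0 : x - m%:R != 0 by rewrite lt0r_neq0//; lra.
have -> : x + 1 - (m%:R + 1) = x - m%:R by ring.
by rewrite subrK; field; rewrite f0 p0 xm0.
Qed.

(** * A rational minorant of the logarithm *)

Section LogBound.
Local Open Scope classical_set_scope.
Local Open Scope ring_scope.

(** A rational function below [ln], tangent to it at 1. It is
    [(1 + 1/t) (H - H')] for the function [H] called [minor_prim] below; the
    coefficients of [H] are chosen so that the difference with [ln] is unimodal
    with minimum 0 at 1 and that [H 0] is still positive. *)
Definition ln_minor (R : realType) (t : R) : R :=
  - t ^+ 2 / 20 + 39 / 80 * t + 29 / 80 - 7 / 40 * t^-1
  - 3 / 4 * (1 + t)^-1 - (1 + t) ^- 2.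

(** The derivative of [ln - ln_minor] has the sign of [t - 1], and the difference
    vanishes at 1. *)
Lemma ln_minor_le_ln (R : realType) (t : R) : 0 < t -> ln_minor t <= ln t.
Proof.
move=> t0.
pose P (c : R) :=
  8 * c ^+ 5 - 7 * c ^+ 4 - 20 * c ^+ 3 + 37 * c ^+ 2 - 24 * c + 14.
have P_gt0 (c : R) : 0 < c -> 0 < P c.
  move=> c0.
  (* With [37 c^2] split as [26 c^2 + 11 c^2]; the cubic [8 c^3 - 7 c^2 - 20 c + 26]
     has its positive minimum at [5/4]. *)
  have -> : P c = c ^+ 2 * ((c - 5 / 4) ^+ 2 * (8 * c + 13) + 91 / 16)
                  + (11 * (c - 12 / 11) ^+ 2 + 10 / 11) by rewrite /P; field.
  have c2 : 0 <= c ^+ 2 by apply: sqr_ge0.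
  have d2 : 0 <= (c - 5 / 4) ^+ 2 by apply: sqr_ge0.
  have e2 : 0 <= (c - 12 / 11) ^+ 2 by apply: sqr_ge0.
  have : 0 <= (c - 5 / 4) ^+ 2 * (8 * c + 13) by apply: mulr_ge0 => //; lra.
  set u := (c - 5 / 4) ^+ 2 * _ => u0.
  have : 0 <= c ^+ 2 * (u + 91 / 16) by apply: mulr_ge0 => //; lra.
  by lra.
pose df (c : R) := (c - 1) * (P c / (80 * c ^+ 2 * (1 + c) ^+ 3)).
pose f (c : R) := ln c - ln_minor c.
have dfE (c : R) : 0 < c -> is_derive c 1 f (df c).
  move=> c0; have c1 : 1 + c != 0 by apply: lt0r_neq0; lra.
  have cn0 : c != 0 by apply: lt0r_neq0.
  have i1 : is_derive c 1 (fun x : R => x^-1) (- c ^- 2).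
    by apply: is_derive_eq (is_deriveV cn0 (is_derive_id c 1)) _; rewrite /GRing.scale /= mulr1.
  have d2 : is_derive c 1 (fun x : R => 1 + x) 1.
    by apply: is_derive_eq; ring.
  have i2 : is_derive c 1 (fun x : R => (1 + x)^-1) (- (1 + c) ^- 2).
    by apply: is_derive_eq (is_deriveV c1 d2) _; rewrite /GRing.scale /= mulr1.
  have i3 : is_derive c 1 (fun x : R => (1 + x) ^- 2) (- 2 * (1 + c) ^- 3).
    rewrite (_ : (fun x : R => (1 + x) ^- 2) = (fun x => (1 + x)^-1) ^+ 2).
      by apply: is_derive_eq; rewrite /GRing.scale /=; field.
    by apply/funext => x; rewrite -[RHS]/((1 + x)^-1 * (1 + x)^-1) -invfM.
  have i0 : is_derive c 1 (fun x : R => - x ^+ 2 / 20 + 39 / 80 * x + 29 / 80)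
                          (- c / 10 + 39 / 80).
    by apply: is_derive_eq; rewrite /GRing.scale /=; field.
  have il := is_derive1_ln c0.
  pose K (k : R) (g : R -> R) dg (dg' : is_derive c 1 g dg) :=
    @is_deriveZ _ _ _ g k c 1 dg dg'.
  have := is_deriveB il (is_deriveB (is_deriveB (is_deriveB i0
    (K (7 / 40) _ _ i1)) (K (3 / 4) _ _ i2)) i3).
  move=> /is_derive_eq; apply.
  rewrite /df /P /GRing.scale /=.
  by field; rewrite c1 cn0.
have dfM (c : R) : 0 < c -> exists2 q : R, 0 < q & df c = (c - 1) * q.
  move=> c0; exists (P c / (80 * c ^+ 2 * (1 + c) ^+ 3)) => //.
  by rewrite divr_gt0 ?P_gt0// !mulr_gt0 ?exprn_gt0//; lra.
have f1 : f 1 = 0 by rewrite /f /ln_minor ln1 invr1 expr1n; field.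
rewrite -subr_ge0 -/(f t).
have cf (a b : R) : 0 < a -> {within `[a, b]%classic, continuous f}.
  move=> a0; apply: derivable_within_continuous => x; rewrite in_itv/= => /andP[ax _].
  by have [] := dfE x (lt_le_trans a0 ax).
have dfI (a b : R) : 0 < a -> forall x, x \in `]a, b[ -> is_derive x 1 f (df x).
  by move=> a0 x; rewrite in_itv/= => /andP[ax _]; exact: dfE (lt_trans a0 ax).
have [t1|t1|->] := ltgtP t 1; last by rewrite f1.
- have [c] := MVT t1 (dfI _ _ t0) (cf _ _ t0).
  rewrite in_itv/= => /andP[tc c1]; rewrite f1 => E.
  have [q q0 Eq] := dfM c (lt_trans t0 tc).
  have -> : f t = (1 - c) * q * (1 - t) by move: E; rewrite Eq; lra.
  by rewrite !mulr_ge0 //; lra.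
- have [c] := MVT t1 (dfI _ _ ltr01) (cf _ _ ltr01).
  rewrite in_itv/= => /andP[tc c1]; rewrite f1 subr0 => ->.
  have [q q0 ->] := dfM c (lt_trans ltr01 tc).
  by rewrite !mulr_ge0 //; lra.
Qed.

End LogBound.

(** * Integrals of exponentially decaying functions *)

Section ExponentialDecay.
Local Open Scope classical_set_scope.
Local Open Scope ring_scope.
Variable R : realType.
Implicit Types (f g F : R -> R) (a c s t : R).
Local Notation mu := (@lebesgue_measure R).
Local Notation halfline := (`[0%R, +oo[%classic : set R).

(** Half of the weight [expR (- t)] is kept as the dominating function, so that the
    other half can absorb powers of [t]. *)
Definition exp_decay f :=
  exists C : R, forall t, 0 <= t -> `|f t| <= C * expR (- t / 2).

Lemma exp_decay_le f g :
  exp_decay g -> (forall t, 0 <= t -> `|f t| <= `|g t|) -> exp_decay f.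
Proof. by case=> C gC fg; exists C => t t0; apply: le_trans (fg t t0) (gC t t0). Qed.

Lemma exp_decayD f g : exp_decay f -> exp_decay g -> exp_decay (fun t => f t + g t).
Proof.
case=> C fC [D gD]; exists (C + D) => t t0; rewrite mulrDl.
by apply: le_trans (ler_normD _ _) _; apply: lerD; [exact: fC|exact: gD].
Qed.

Lemma exp_decayZ c f : exp_decay f -> exp_decay (fun t => c * f t).
Proof.
case=> C fC; exists (`|c| * C) => t t0; rewrite normrM -mulrA.
by apply: ler_wpM2l => //; exact: fC.
Qed.

(** For [a > 0], [ln t <= t / (2 a) + ln (2 a)] gives
    [t `^ a <= (2 a) `^ a * expR (t / 2)]. *)
Lemma exp_decay_powR a : 0 <= a -> exp_decay (fun t => t `^ a * expR (- t)).
Proof.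
rewrite le_eqVlt => /predU1P[<-|a0].
  exists 1 => t t0; rewrite powRr0 !mul1r ger0_norm ?expR_ge0//.
  by rewrite ler_expR; lra.
exists (expR (a * ln (2 * a))) => t t0.
rewrite ger0_norm ?mulr_ge0 ?powR_ge0 ?expR_ge0//.
have -> : expR (- t) = expR (- t / 2) * expR (- t / 2).
  by rewrite -expRD; congr expR; lra.
rewrite mulrA ler_wpM2r ?expR_ge0//.
rewrite -ler_pdivlMr ?expR_gt0// -expRN -expRD.
have [->|tn0] := eqVneq t 0; first by rewrite powR0 ?gt_eqF// expR_ge0.
have tp : 0 < t by rewrite lt_neqAle eq_sym tn0.
rewrite /powR (negbTE tn0) ler_expR.
have lnt : ln t = ln (t / (2 * a)) + ln (2 * a).
  rewrite -lnM ?posrE ?divr_gt0 ?mulr_gt0//; congr ln; field.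
  by rewrite gt_eqF.
have le1 : ln (t / (2 * a)) <= t / (2 * a).
  by rewrite ltW// ln_sublinear// divr_gt0// mulr_gt0.
have -> : a * ln (2 * a) + - (- t / 2) = a * (t / (2 * a) + ln (2 * a)).
  by field; rewrite gt_eqF.
by rewrite ler_pM2l// lnt lerD2r.
Qed.

Lemma cvg_expR_half : expR (- t / 2) @[t --> +oo%R] --> (0 : R).
Proof.
have -> : (fun t : R => expR (- t / 2)) = (fun t => expR (- t)) \o (fun t => t / 2).
  by apply/funext => t /=; rewrite mulNr.
apply: (@cvg_comp _ _ _ _ _ _ (@pinfty_nbhs R)); last exact: cvgr_expR.
by apply: gt0_cvgMly => //; exact: cvg_id.
Qed.

Lemma exp_decay_cvg f : exp_decay f -> f t @[t --> +oo%R] --> (0 : R).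
Proof.
case=> C fC; apply/norm_cvg0P.
apply: (@squeeze_cvgr _ _ _ _ (cst 0) (fun t => C * expR (- t / 2))).
- near=> t; rewrite normr_ge0/=; apply: fC; near: t; exact: nbhs_pinfty_ge.
- exact: cvg_cst.
- rewrite -[X in _ --> X](mulr0 C); apply: cvgM; first exact: cvg_cst.
  exact: cvg_expR_half.
Unshelve. all: by end_near. Qed.

Lemma is_derive_expR_half t :
  is_derive t 1 (fun t : R => expR (- t / 2)) (- expR (- t / 2) / 2).
Proof. by apply: is_derive_eq; rewrite /GRing.scale /=; lra. Qed.

Lemma continuous_expR_half : continuous (fun t : R => expR (- t / 2)).
Proof.
move=> t; apply: differentiable_continuous; apply/derivable1_diffP.
by have [] := is_derive_expR_half t.
Qed.

Lemma integral_expR_half : (\int[mu]_(t in halfline) (expR (- t / 2))%:E = 2%:E)%E.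
Proof.
have dF t : is_derive t 1 (fun t : R => - 2 * expR (- t / 2)) (expR (- t / 2)).
  have := is_deriveZ (- 2) (is_derive_expR_half t).
  by move=> /is_derive_eq; apply; rewrite /GRing.scale /=; lra.
rewrite (@ge0_continuous_FTC2y _ _ (fun t : R => - 2 * expR (- t / 2)) 0 0).
- by rewrite oppr0 mul0r expR0 mulr1 sub0e -EFinN opprK.
- by move=> t _; exact: expR_ge0.
- by apply: continuous_subspaceT => t; exact: continuous_expR_half.
- by rewrite -[X in _ --> X](mulr0 (-2)); apply: cvgM; [exact: cvg_cst|exact: cvg_expR_half].
- by move=> t _; have [] := dF t.
- apply: cvg_at_right_filter; apply: cvgM; [exact: cvg_cst|exact: continuous_expR_half].
- by move=> t _; rewrite derive1E; have [_ ->] := dF t.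
Qed.

Lemma integrable_expR_half :
  mu.-integrable halfline (EFin \o (fun t : R => expR (- t / 2))).
Proof.
apply/integrableP; split.
  apply/measurable_EFinP; apply: measurable_funTS.
  by apply: continuous_measurable_fun => t; exact: continuous_expR_half.
under eq_integral do rewrite /= ger0_norm ?expR_ge0//.
by rewrite integral_expR_half ltry.
Qed.

Lemma integrable_exp_decay f :
  measurable_fun halfline f -> exp_decay f -> mu.-integrable halfline (EFin \o f).
Proof.
move=> mf [C fC].
apply: (le_integrable _ _ _ (integrableZl _ C integrable_expR_half)) => //.
  exact/measurable_EFinP.
move=> t; rewrite /= in_itv/= andbT => t0; rewrite lee_fin.
by apply: le_trans (fC t t0) _; exact: ler_norm.
Qed.

(** Adding the dominating exponential [e] to [f] reduces the fundamental theorem of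
    calculus on the half-line to its version for nonnegative integrands; the
    integral of [e] is then subtracted. *)
Lemma Rintegral_exp_decay_FTC f F :
  {within halfline, continuous f} -> exp_decay f -> exp_decay F ->
  F t @[t --> 0^'+] --> F 0 ->
  (forall t, 0 < t -> is_derive t 1 F (f t)) ->
  \int[mu]_(t in halfline) f t = - F 0.
Proof.
move=> cf df dF F0 FE.
have mf : measurable_fun halfline f by exact: subspace_continuous_measurable_fun.
have intf := integrable_exp_decay mf df.
have [C fC] := df.
have Fy := exp_decay_cvg dF.
pose e t := C * expR (- t / 2).
have ce : continuous e by move=> t; apply: cvgM; [exact: cvg_cst|exact: continuous_expR_half].
have inte : mu.-integrable halfline (EFin \o e).
  exact: integrableZl integrable_expR_half.
have IE : \int[mu]_(t in halfline) e t = 2 * C.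
  rewrite RintegralZl//; last exact: integrable_expR_half.
  by rewrite /Rintegral integral_expR_half /= mulrC.
pose G t := F t - 2 * e t.
have GE t : 0 < t -> is_derive t 1 G (f t + e t).
  move=> t0; have := is_deriveB (FE t t0) (is_deriveZ (2 * C) (is_derive_expR_half t)).
  rewrite (_ : F - _ = G).
    by move=> /is_derive_eq; apply; rewrite /e /GRing.scale /=; lra.
  by apply/funext => u; rewrite /G /e mulrA.
have : \int[mu]_(t in halfline) (f t + e t) = 0 - G 0.
  apply: Rintegral_ge0_continuous_FTC2y.
  - move=> t t0; have := fC t t0; rewrite ler_norml => /andP[+ _].
    by rewrite /e -subr_ge0 opprK.
  - by move=> t; apply: cvgD; [exact: cf|apply: continuous_subspaceT].
  - rewrite -[X in _ --> X](subr0 0); apply: cvgB => //.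
    rewrite -[X in _ --> X](mulr0 2); apply: cvgM; first exact: cvg_cst.
    rewrite -[X in _ --> X](mulr0 C); apply: cvgM; first exact: cvg_cst.
    exact: cvg_expR_half.
  - by move=> t t0; have [] := GE t t0.
  - apply: cvgB => //; apply: cvgM; first exact: cvg_cst.
    exact/cvg_at_right_filter/ce.
  - move=> t; rewrite in_itv/= andbT => t0.
    by rewrite derive1E; have [_ ->] := GE t t0.
rewrite RintegralD// IE /G /e oppr0 mul0r expR0 mulr1; lra.
Qed.

End ExponentialDecay.

(** * Functional equations of Gamma and of the Kurepa function *)

Section GammaAndKurepa.
Local Open Scope classical_set_scope.
Local Open Scope ring_scope.
Variable R : realType.
Implicit Types (f g F : R -> R) (a c s t x y : R).
Local Notation mu := (@lebesgue_measure R).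
Local Notation halfline := (`[0%R, +oo[%classic : set R).

Lemma powR_within_continuous a : 0 < a ->
  {within halfline, continuous (fun t => t `^ a)}.
Proof.
move=> a0; apply/continuous_within_itvcyP; split.
  move=> t; rewrite in_itv/= andbT => t0.
  by apply: differentiable_continuous; apply/derivable1_diffP; have [] := is_derive1_powR a t0.
by rewrite powR0 ?gt_eqF//; exact: powR_cvg0.
Qed.

Lemma is_derive_expRN t : is_derive t 1 (fun t : R => expR (- t)) (- expR (- t)).
Proof. by apply: is_derive_eq; rewrite /GRing.scale /=; lra. Qed.

Lemma continuous_expRN : continuous (fun t : R => expR (- t)).
Proof.
move=> t; apply: differentiable_continuous; apply/derivable1_diffP.
by have [] := is_derive_expRN t.
Qed.

Lemma measurable_expRN (D : set R) : measurable_fun D (fun t => expR (- t)).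
Proof.
by apply: measurable_funTS; apply: continuous_measurable_fun; exact: continuous_expRN.
Qed.

Lemma powR_expRN_within_continuous a : 0 < a ->
  {within halfline, continuous (fun t => t `^ a * expR (- t))}.
Proof.
move=> a0 t; apply: cvgM; first exact: powR_within_continuous.
by apply: continuous_subspaceT; exact: continuous_expRN.
Qed.

Lemma integrable_Gamma a : 0 <= a ->
  mu.-integrable halfline (EFin \o (fun t => t `^ a * expR (- t))).
Proof.
move=> a0; apply: integrable_exp_decay; last exact: exp_decay_powR.
apply: measurable_funM; first by apply: measurable_funTS; exact: measurable_powR.
exact: measurable_expRN.
Qed.

(** The primitive of [t `^ s * expR (- t) - s * (t `^ (s - 1) * expR (- t))] is
    [- (t `^ s * expR (- t))], which vanishes at both ends. *)
Lemma GammaS s : 1 < s -> Gamma (s + 1) = s * Gamma s.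
Proof.
move=> s1; rewrite /Gamma addrK.
have s0 : 0 < s by lra.
have sp : 0 < s - 1 by lra.
have IS := integrable_Gamma (ltW sp).
have I1 := integrable_Gamma (ltW s0).
apply/eqP; rewrite -subr_eq0 -RintegralZl// -RintegralB//; last first.
  exact: (integrableZl _ s IS).
apply/eqP.
pose F t : R := - (t `^ s * expR (- t)).
transitivity (- F 0); last by rewrite /F powR0 ?gt_eqF// mul0r !oppr0.
apply: Rintegral_exp_decay_FTC.
- move=> t; apply: cvgB; first exact: powR_expRN_within_continuous.
  by apply: cvgM; [exact: cvg_cst|exact: powR_expRN_within_continuous].
- rewrite (_ : (fun t => _) =
      (fun t => t `^ s * expR (- t) + - s * (t `^ (s - 1) * expR (- t)))).
    by apply: exp_decayD; [|apply: exp_decayZ]; apply: exp_decay_powR; lra.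
  by apply/funext => t; rewrite mulNr.
- rewrite (_ : F = (fun t => - 1 * (t `^ s * expR (- t)))).
    by apply: exp_decayZ; apply: exp_decay_powR; lra.
  by apply/funext => t; rewrite /F mulN1r.
- have /continuous_within_itvcyP[_ h] := powR_expRN_within_continuous s0.
  exact: cvgN h.
- move=> t t0.
  have := is_deriveN (is_deriveM (is_derive1_powR s t0) (is_derive_expRN t)).
  by move=> /is_derive_eq; apply; rewrite /GRing.scale /=; ring.
Qed.

Definition ReA x : R := \int[mu]_(t in halfline)
  (expR (- t) * ((t `^ (x + 1) - cos (pi * x) * t) / (t + 1))).

Lemma Re_kurepaA x : complex.Re (kurepaA x) = ReA x.
Proof.
rewrite /kurepaA /Cintegral /ReA; apply: eq_Rintegral => t _.
have ReM (r : R) (z : R[i]) : complex.Re (r%:C%C * z) = r * complex.Re z.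
  by case: z => u v /=; rewrite mul0r subr0.
have inv (r : R) : (r%:C^-1 = (r^-1)%:C)%C by rewrite (fmorphV (real_complex R)).
rewrite inv.
rewrite ReM mulrC [in LHS](mulrC _ (_^-1)%:C%C) ReM /= !mulr0 !subr0.
by rewrite mulrC [in RHS](mulrC _ (t + 1)^-1).
Qed.

Lemma integrable_ReA x : 0 <= x + 1 ->
  mu.-integrable halfline (EFin \o
    (fun t => expR (- t) * ((t `^ (x + 1) - cos (pi * x) * t) / (t + 1)))).
Proof.
move=> x0; apply: integrable_exp_decay.
  apply: measurable_funM.
    exact: measurable_expRN.
  apply: measurable_funM.
    apply: measurable_funTS; apply: measurable_funB; first exact: measurable_powR.
    by apply: measurable_funM => //; exact: measurable_cst.
  apply: subspace_continuous_measurable_fun => //.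
  apply: derivable_within_continuous => t; rewrite in_itv/= andbT => t0.
  by apply: derivableV => //; apply: lt0r_neq0; lra.
apply: (@exp_decay_le _ _
  (fun t => t `^ (x + 1) * expR (- t) + t `^ 1 * expR (- t))).
  by apply: exp_decayD; apply: exp_decay_powR; lra.
move=> t t0; rewrite powRr1//.
have p0 : 0 <= t `^ (x + 1) by exact: powR_ge0.
have e0 : 0 <= expR (- t) by exact: expR_ge0.
rewrite [leRHS]ger0_norm ?addr_ge0 ?mulr_ge0// -mulrDl mulrC normrM (ger0_norm e0).
rewrite ler_wpM2r// normrM normfV [`|t + 1|]ger0_norm; last by lra.
rewrite ler_pdivrMr; last by lra.
apply: (@le_trans _ _ (t `^ (x + 1) + t)); last by nra.
apply: le_trans (ler_normB _ _) _; rewrite (ger0_norm p0) normrM (ger0_norm t0) lerD2l.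
have : `|cos (pi * x)| <= 1 by rewrite ler_norml cos_geN1 cos_le1.
by move=> c1; rewrite -[leRHS]mul1r ler_wpM2r.
Qed.

(** [cos (pi * x)] changes sign when [x] increases by 1, so its terms cancel and
    the factor [t + 1] that remains in the numerator kills the denominator. *)
Lemma ReA_rec y : 0 <= y -> ReA (y + 1) + ReA y = Gamma (y + 2).
Proof.
move=> y0; rewrite /ReA -RintegralD//; try by apply: integrable_ReA; lra.
apply: eq_Rintegral => t; rewrite inE/= in_itv/= andbT => t0.
have t1 : t + 1 != 0 by apply: lt0r_neq0; lra.
have -> : cos (pi * (y + 1)) = - cos (pi * y) by rewrite mulrDr mulr1 cosDpi.
have -> : t `^ (y + 1 + 1) = t `^ (y + 1) * t.
  rewrite powRD ?powRr1//; apply/implyP => h.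
  by exfalso; move: h; apply/negP/lt0r_neq0; lra.
have -> : y + 2 - 1 = y + 1 by ring.
by field.
Qed.

Lemma ReA0 : ReA 0 = 0.
Proof.
rewrite /ReA (@eq_Rintegral _ _ _ _ _ (cst 0)).
  by rewrite Rintegral_cst// mul0r.
move=> t; rewrite inE/= in_itv/= andbT => t0.
by rewrite add0r powRr1// mulr0 cos0 mul1r subrr mul0r mulr0.
Qed.

End GammaAndKurepa.

(** * Positivity of the Kurepa function *)

Section Positivity.
Local Open Scope classical_set_scope.
Local Open Scope ring_scope.
Variable R : realType.
Implicit Types (t x y : R).
Local Notation mu := (@lebesgue_measure R).
Local Notation halfline := (`[0%R, +oo[%classic : set R).

(** The function [H] of the comment on [ln_minor]; its value at 0 is [1/80], which
    is therefore the integral of [(H - H') exp(-t)] over the half-line. *)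
Definition minor_prim t : R :=
  - t ^+ 2 / 20 + 7 / 16 * t + 21 / 80 - 3 / 4 * (1 + t)^-1 + (1 + t)^-1 ^+ 2 / 2.

(** [H - H'] for [H = minor_prim], which is also [t * ln_minor t / (t + 1)]; unlike
    the latter expression it is continuous at 0. *)
Definition minor t : R :=
  - t ^+ 2 / 20 + 43 / 80 * t - 7 / 40 - 3 / 4 * (1 + t)^-1
  - (1 + t)^-1 ^+ 2 / 4 + (1 + t)^-1 ^+ 3.

Lemma minorE t : 0 < t -> minor t = t * ln_minor t / (t + 1).
Proof.
move=> t0; rewrite /minor /ln_minor; field.
by rewrite !lt0r_neq0//; lra.
Qed.

Lemma is_derive_inv1D t : 0 <= t ->
  is_derive t 1 (fun t : R => (1 + t)^-1) (- (1 + t)^-1 ^+ 2).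
Proof.
move=> t0; have t1 : 1 + t != 0 by apply: lt0r_neq0; lra.
have d : is_derive t 1 (fun x : R => 1 + x) 1 by apply: is_derive_eq; ring.
by apply: is_derive_eq (is_deriveV t1 d) _; rewrite /GRing.scale /= mulr1 exprVn.
Qed.

Lemma minor_within_continuous : {within halfline, continuous minor}.
Proof.
apply: derivable_within_continuous => t; rewrite in_itv/= andbT => t0.
have [du _] := is_derive_inv1D t0.
have dp : derivable (fun t : R => - t ^+ 2 / 20 + 43 / 80 * t - 7 / 40) t 1
  by exact: ex_derive.
have dc (c : R) : derivable (fun _ : R => c) t 1 by exact: derivable_cst.
have du2 := derivableM du du.
have dk := derivableD (derivableB (derivableB dp (derivableM (dc (3 / 4)) du))
  (derivableM du2 (dc 4^-1))) (derivableM du2 du).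
apply: (eq_ind _ (fun f => derivable f t 1) dk); apply/funext => s.
rewrite /minor /= !fctE; ring.
Qed.

Lemma exp_decay_quadratic (f : R -> R) :
  (forall t, 0 <= t -> `|f t| <= t ^+ 2 + t + 3) ->
  exp_decay (fun t => f t * expR (- t)).
Proof.
move=> fb; apply: (@exp_decay_le _ _ (fun t => (t `^ 2%:R * expR (- t) +
   t `^ 1 * expR (- t)) + 3 * (t `^ 0 * expR (- t)))).
  apply: exp_decayD; first by apply: exp_decayD; exact: exp_decay_powR.
  by apply: exp_decayZ; exact: exp_decay_powR.
move=> t t0; rewrite powR_mulrn// powRr1// powRr0 mul1r -!mulrDl !normrM.
apply: ler_wpM2r => //; apply: le_trans (fb t t0) _; exact: ler_norm.
Qed.

Lemma minor_bound t : 0 <= t -> `|minor t| <= t ^+ 2 + t + 3.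
Proof.
move=> t0; rewrite /minor.
have u0 : 0 <= (1 + t)^-1 by rewrite invr_ge0; lra.
have u1 : (1 + t)^-1 <= 1 by rewrite invf_le1; lra.
set u := (1 + t)^-1 in u0 u1 *.
have ? : 0 <= u ^+ 2 <= 1 by rewrite exprn_ge0//= exprn_ile1.
have ? : 0 <= u ^+ 3 <= 1 by rewrite exprn_ge0//= exprn_ile1.
have ? : 0 <= t ^+ 2 by rewrite exprn_ge0.
rewrite ler_norml; apply/andP; split; lra.
Qed.

Lemma minor_prim_bound t : 0 <= t -> `|- minor_prim t| <= t ^+ 2 + t + 3.
Proof.
move=> t0; rewrite /minor_prim.
have u0 : 0 <= (1 + t)^-1 by rewrite invr_ge0; lra.
have u1 : (1 + t)^-1 <= 1 by rewrite invf_le1; lra.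
set u := (1 + t)^-1 in u0 u1 *.
have ? : 0 <= u ^+ 2 <= 1 by rewrite exprn_ge0//= exprn_ile1.
have ? : 0 <= t ^+ 2 by rewrite exprn_ge0.
rewrite ler_norml; apply/andP; split; lra.
Qed.

Lemma is_derive_minor_prim t : 0 <= t ->
  is_derive t 1 (fun t => - minor_prim t * expR (- t)) (minor t * expR (- t)).
Proof.
move=> t0; have du := is_derive_inv1D t0.
have dp : is_derive t 1 (fun t : R => - t ^+ 2 / 20 + 7 / 16 * t + 21 / 80)
                        (- t / 10 + 7 / 16).
  by apply: is_derive_eq; rewrite /GRing.scale /=; field.
have dk : is_derive t 1 (fun t => - minor_prim t) (- (minor_prim t - minor t)).
  have := is_deriveN (is_deriveD (is_deriveB dp (is_deriveZ (3 / 4) du))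
     (is_deriveZ 2^-1 (is_deriveM du du))).
  rewrite (_ : - _ = (fun t => - minor_prim t)).
    by move=> /is_derive_eq; apply; rewrite /minor_prim /minor /GRing.scale /=; field; lra.
  apply/funext => s; rewrite /minor_prim !fctE; congr (- (_ + _)).
  by rewrite [RHS]mulrC expr2.
have := is_deriveM dk (is_derive_expRN t).
by move=> /is_derive_eq; apply; rewrite /GRing.scale /=; ring.
Qed.

Lemma integral_minor : \int[mu]_(t in halfline) (minor t * expR (- t)) = 80^-1.
Proof.
pose F t := - minor_prim t * expR (- t).
transitivity (- F 0).
  apply: Rintegral_exp_decay_FTC.
  - move=> t; apply: cvgM; first exact: minor_within_continuous.
    by apply: continuous_subspaceT; exact: continuous_expRN.
  - exact/exp_decay_quadratic/minor_bound.
  - exact/exp_decay_quadratic/minor_prim_bound.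
  - apply: cvg_at_right_filter; apply: differentiable_continuous.
    by apply/derivable1_diffP; have [] := is_derive_minor_prim (lexx 0).
  - by move=> t t0; exact/is_derive_minor_prim/ltW.
rewrite /F /minor_prim oppr0 expR0 addr0 invr1 expr1n expr0n /=; lra.
Qed.

Lemma integrable_minor :
  mu.-integrable halfline (EFin \o (fun t => minor t * expR (- t))).
Proof.
apply: integrable_exp_decay; last exact/exp_decay_quadratic/minor_bound.
apply: measurable_funM.
  by apply: subspace_continuous_measurable_fun => //; exact: minor_within_continuous.
exact: measurable_expRN.
Qed.

(** Since [cos <= 1] and [t `^ y = expR (y * ln t) >= 1 + y * ln t], the numerator
    of the integrand is at least [t * (y * ln t)]. A linear lower bound is needed
    because [ReA] vanishes at 0 with a derivative of only about 0.03; this is why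
    the minorant of [ln] has to be so tight. *)
Lemma ReA_ge y : 0 <= y -> y / 80 <= ReA y.
Proof.
move=> y0; rewrite -integral_minor -RintegralZl//; last exact: integrable_minor.
apply: le_Rintegral => //; last 2 first.
- by apply: integrable_ReA; lra.
- move=> t; rewrite /= in_itv/= andbT => t0.
  rewrite [leLHS]mulrA [leLHS]mulrC; apply: ler_wpM2l; first exact: expR_ge0.
  move: t0; rewrite le_eqVlt => /predU1P[<-|t0].
    rewrite powR0 ?lt0r_neq0//; last by lra.
    rewrite /minor addr0 invr1 !expr1n expr0n /=; lra.
  rewrite minorE// [y * _]mulrA ler_wpM2r ?invr_ge0//; first by lra.
  have -> : t `^ (y + 1) = t `^ y * t.
    by rewrite powRD ?powRr1 ?ltW// (negbTE (lt0r_neq0 t0)) implybT.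
  have tn0 : t == 0 = false by apply/negbTE/lt0r_neq0.
  have ty : 1 + y * ln t <= t `^ y by rewrite /powR tn0 expR_ge1Dx.
  have yk : y * ln_minor t <= y * ln t by rewrite ler_wpM2l ?ln_minor_le_ln.
  have c1 : cos (pi * y) <= 1 by exact: cos_le1.
  rewrite mulrCA [_ * t]mulrC [cos _ * t]mulrC -mulrBr ler_pM2l//.
  lra.
- exact: (integrableZl _ y integrable_minor).
Qed.

End Positivity.

(** * The double inequality *)

(** Positivity of [Gamma] comes for free: [ReA_rec] writes it as a sum of two
    nonnegative values of [ReA], one of them positive. *)
Lemma Gamma_gt0 (R : realType) (y : R) : 0 <= y -> 0 < Gamma (y + 2).
Proof.
move=> y0; rewrite -ReA_rec//.
have := ReA_ge y0; have : 0 <= y + 1 by lra.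
by move=> /ReA_ge; lra.
Qed.

Lemma Gamma_falling (R : realType) (m : nat) (x : R) : m%:R <= x ->
  Gamma (x + 2) = falling m (x + 1) * Gamma (x - m%:R + 2).
Proof.
elim: m => [|m IH]; first by rewrite /falling big_ord0 mul1r subr0.
rewrite -natr1 => mx; rewrite IH; last by lra.
rewrite fallingS -mulrA; congr (_ * _).
have -> : x - (m%:R + 1) + 2 = x + 1 - m%:R by ring.
by rewrite -GammaS; [congr Gamma; ring|lra].
Qed.

(** Unfolding [ReA x = Gamma (x + 1) - ReA (x - 1)] [m] times: the accumulated
    alternating sum of Gamma values is [kurepa_r m x * Gamma (x + 2)] up to sign. *)
Lemma ReA_descent (R : realType) (m : nat) (x : R) : m%:R <= x ->
  ReA x = (-1) ^+ m * (kurepa_r m x * Gamma (x + 2) + ReA (x - m%:R)).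
Proof.
elim: m => [_|m IH]; first by rewrite /= expr0 mul1r mul0r add0r subr0.
rewrite -natr1 => mx; rewrite IH; last by lra.
have y0 : 0 <= x - (m%:R + 1) by lra.
have := ReA_rec y0; have -> : x - (m%:R + 1) + 1 = x - m%:R by ring.
move=> /(canRL (addrK _)) ->.
have f0 : falling m.+1 (x + 1) != 0 by rewrite lt0r_neq0// falling_gt0// -natr1; lra.
have := @kurepa_r_succ_add _ m x; rewrite (_ : m%:R < x + 1); last by lra.
move=> /(_ isT) /(canRL (addrK _)) ->.
have := @Gamma_falling _ m.+1 x; rewrite -natr1 => /(_ mx) ->.
by rewrite exprS; field.
Qed.

Theorem theorem6 (R : realType) (n k : nat) (hk : k = (2 * n + 1)%N) :
  (forall x : R, k%:R + 1 <= x ->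
     (kurepa_p R k).[x] / ((kurepa_p R k).[x] + 1) * (- kurepa_r k x)
       <= complex.Re (kurepaA x) / Gamma (x + 2)
     /\ complex.Re (kurepaA x) / Gamma (x + 2) < - kurepa_r k x)
  /\ (let x : R := k%:R + 1 in
      (kurepa_p R k).[x] / ((kurepa_p R k).[x] + 1) * (- kurepa_r k x)
        = complex.Re (kurepaA x) / Gamma (x + 2)).
Proof.
have oddk : (-1 : R) ^+ k = -1 by rewrite hk addn1 exprS exprM sqrrN !expr1n mulr1.
(* The gap in the upper bound is [ReA y / Gamma (x + 2)] with [y = x - k >= 1]. *)
have upper (x : R) : k%:R + 1 <= x ->
    complex.Re (kurepaA x) / Gamma (x + 2) =
    - kurepa_r k x - ReA (x - k%:R) / Gamma (x + 2).
  move=> kx; have g0 : Gamma (x + 2) != 0.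
    by rewrite lt0r_neq0// Gamma_gt0//; have := ler0n R k; lra.
  rewrite Re_kurepaA (@ReA_descent _ k); last by lra.
  by rewrite oddk; field.
(* The gap in the lower bound is [ReA (y - 1) / Gamma (x + 2)]; it vanishes for
   [y = 1] because [ReA 0 = 0]. *)
have lower (x : R) : k%:R + 1 <= x ->
    (kurepa_p R k).[x] / ((kurepa_p R k).[x] + 1) * (- kurepa_r k x) =
    complex.Re (kurepaA x) / Gamma (x + 2) - ReA (x - k%:R - 1) / Gamma (x + 2).
  move=> kx; have g0 : Gamma (x + 2) != 0.
    by rewrite lt0r_neq0// Gamma_gt0//; have := ler0n R k; lra.
  have y0 : 0 <= x - k%:R - 1 by lra.
  have := ReA_rec y0; rewrite subrK => /(canRL (addrK _)) AE.
  have := @Gamma_falling _ k.+1 x; rewrite -natr1 => /(_ kx) GE.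
  rewrite upper// AE.
  have -> : x - k%:R - 1 + 2 = x - (k%:R + 1) + 2 by ring.
  have f0 : falling k.+1 (x + 1) != 0.
    by apply: contra_neq g0 => f0; rewrite GE f0 mul0r.
  have G0 : Gamma (x - (k%:R + 1) + 2) != 0.
    by apply: contra_neq g0 => G0; rewrite GE G0 mulr0.
  have -> : (kurepa_p R k).[x] / ((kurepa_p R k).[x] + 1) * (- kurepa_r k x) =
      - kurepa_r k x - (falling k.+1 (x + 1))^-1.
    move: kx; rewrite hk addn1 -natr1 => kx; apply: kurepa_p_quotient.
      by rewrite mul2n odd_double.
    by apply: le_trans kx; rewrite lerDl.
  have -> : (falling k.+1 (x + 1))^-1 = Gamma (x - (k%:R + 1) + 2) / Gamma (x + 2).
    by rewrite GE invfM mulrCA divff// mulr1.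
  ring.
split=> [x kx|x]; last first.
  rewrite lower ?lexx//; have -> : x - k%:R - 1 = 0 by rewrite /x; ring.
  by rewrite ReA0 mul0r subr0.
have g0 : 0 < Gamma (x + 2) by rewrite Gamma_gt0//; have := ler0n R k; lra.
split.
  rewrite lower// gerBl divr_ge0 ?(ltW g0)//.
  have y0 : 0 <= x - k%:R - 1 by lra.
  by apply: le_trans (ReA_ge y0); rewrite divr_ge0.
rewrite upper// gtrBl divr_gt0//.
have y0 : 0 <= x - k%:R by lra.
by apply: lt_le_trans (ReA_ge y0); rewrite divr_gt0//; lra.
Qed.
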